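(* Let $a,b$ be non-zero real numbers, and let $(J_n)_{n\ge 0}$ be the bi-periodic Jacobsthal matrix sequence associated with $a,b$. Then for every positive integer $n$, $$\sum_{k=0}^{n-1}J_k=\frac{J_n\left(1-a^{\varepsilon(n)}b^{1-\varepsilon(n)}\right)+2J_{n-1}\left(1-a^{1-\varepsilon(n)}b^{\varepsilon(n)}\right)+J_1(a-1)+J_0(2b-ab-1)}{1-ab}.$$
   Context: Fix non-zero real numbers $a,b$. The parity function is $\varepsilon(n)=0$ if $n$ is even and $\varepsilon(n)=1$ if $n$ is odd. The bi-periodic Jacobsthal matrix sequence $(J_n)_{n\ge 0}$ of $2\times 2$ real matrices is defined by $J_0=\begin{pmatrix}1&0\\0&1\end{pmatrix}$, $J_1=\begin{pmatrix} b & 2\frac{b}{a}\\ 1&0\end{pmatrix}$, and for $n\ge 2$: $J_n=aJ_{n-1}+2J_{n-2}$ if $n$ is even, $J_n=bJ_{n-1}+2J_{n-2}$ if $n$ is odd. *)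

(* Defs.v *)
From mathcomp Require Import all_boot all_order all_algebra.
From mathcomp Require Import reals.

Set Implicit Arguments.
Unset Strict Implicit.
Unset Printing Implicit Defensive.

Import GRing.Theory.
Local Open Scope ring_scope.

Definition eps (n : nat) : nat := if odd n then 1%N else 0%N.

Section BiperiodicJacobsthal.
Variables (R : realType) (a b : R).

Definition jacobsthal_mx1 : 'M[R]_2 :=
  \matrix_(i < 2, j < 2)
    nth 0 (nth [::] [:: [:: b; 2 * (b / a)];
                        [:: 1; 0         ]] i) j.

Fixpoint jacobsthal_mx (n : nat) : 'M[R]_2 :=
  match n with
  | 0 => 1%:M
  | 1 => jacobsthal_mx1
  | (m.+1 as p).+1 =>
      (if odd n then b else a) *: jacobsthal_mx p + 2 *: jacobsthal_mx m
  end.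

End BiperiodicJacobsthal.

(* Main.v *)
(** The bracket on the right, as a function of [n], is [1 - a b] at [n = 1] (times
    [J 0]), and by the recurrence it increases by [(1 - a b) J n] from [n] to
    [n + 1]; so it is [1 - a b] times the partial sum. *)
Require Import Defs.
From mathcomp Require Import all_boot all_order all_algebra.
From mathcomp Require Import reals.
From mathcomp Require Import ring.

Import GRing.Theory.
Local Open Scope ring_scope.

(** Scalar form, cleared of the denominator so that [ring] suffices; it is applied below to each
    matrix entry. *)
Lemma sum_biperiodic (R : comPzRingType) (a b : R) (u : nat -> R) :
    (forall n, u n.+2 = (if odd n then b else a) * u n.+1 + 2 * u n) ->
  forall n,
  (1 - a * b) * \sum_(0 <= k < n.+1) u k =
    (1 - a ^+ eps n.+1 * b ^+ (1 - eps n.+1)) * u n.+1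
    + 2 * (1 - a ^+ (1 - eps n.+1) * b ^+ eps n.+1) * u n
    + (a - 1) * u 1%N + (2 * b - a * b - 1) * u 0%N.
Proof.
move=> uSS; elim=> [|n IHn]; first by rewrite big_nat1 /eps /=; ring.
rewrite big_nat_recr //= mulrDr IHn uSS /eps /=.
by case: (odd n) => /=; ring.
Qed.

Theorem theorem9 (R : realType) (a b : R) (ha : a != 0) (hb : b != 0)
    (hab : 1 - a * b != 0) (n : nat) (hn : (0 < n)%N) :
  let J := jacobsthal_mx a b in
  \sum_(0 <= k < n) J k =
    (1 - a * b)^-1 *:
      ((1 - a ^+ eps n * b ^+ (1 - eps n)%N) *: J n
       + (2 * (1 - a ^+ (1 - eps n)%N * b ^+ eps n)) *: J n.-1
       + (a - 1) *: J 1%N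
       + (2 * b - a * b - 1) *: J 0%N).
Proof.
move=> J; case: n hn => // n _.
apply: (scalerI hab); rewrite scalerA divff // scale1r.
(* The recurrence is linear with scalar coefficients, so each matrix entry satisfies it
   separately. *)
apply/matrixP => i j.
have JSS m : J m.+2 i j = (if odd m then b else a) * J m.+1 i j + 2 * J m i j.
  by rewrite {1}/J /= negbK !mxE.
rewrite [LHS]mxE summxE.
rewrite (sum_biperiodic _ a b (fun m => J m i j) JSS n).
(* Hiding the body of [J] keeps [mxE] from expanding [J 0] and [J 1] into explicit entries. *)
by clearbody J; rewrite !mxE.
Qed.
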